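(* Let $k$ be a field of characteristic $p \in \mathbb{Z}_{\geq 0}$. (1) Let $d \in \mathbb{Z}_{\geq 2}$. Then the convex hull in $\mathbb{R}^2$ of the points $(0,0)$, $(1,d-1)$, $(d,0)$ together with all points $(i_1,i_2)$ with $i_1,i_2 \in \mathbb{Z}_{\geq 1}$ and $2 \leq i_1+i_2 \leq d$ is equal to the convex hull of the three points $(0,0)$, $(1,d-1)$, $(d,0)$, and this polytope is an integrally indecomposable triangle. (2) Let $f \in k[X]$ with $d = \deg(f) > 0$, and let $a \in k^\times = k\setminus\{0\}$. If $p > 0$, assume in addition that $\gcd(d,p)=1$. Then the polynomial $F = f(x) - f(y) + a \in k[x,y]$ is absolutely irreducible over $k$.
   Context: A polytope in $\mathbb{R}^n$ is the convex hull of a finite set of points; it is called integral if all its vertices lie in $\mathbb{Z}^n$. The Minkowski sum of $A,B\subset\mathbb{R}^n$ is $A+B=\{a+b \mid a\in A, b\in B\}$. An integral polytope $C$ is integrally decomposable if $C = A+B$ with $A,B$ integral polytopes (as usual, this is understood non-trivially: both $A$ and $B$ have at least two points); otherwise it is integrally indecomposable. A triangle is a polytope generated by three distinct points (here not all on one line). A polynomial in $k[x_1,\dots,x_n]$ is irreducible if it is non-zero, not a unit, and in every factorization $f=g\cdot h$ one of $g,h$ lies in $k^\times$; it is absolutely irreducible if it remains irreducible over every algebraic field extension $k\subset K$. *)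

(* Defs.v *)
From mathcomp Require Import all_boot all_order all_algebra.
From mathcomp Require Import boolp classical_sets cardinality reals convex.
From mathcomp.multinomials Require Import mpoly.

Set Implicit Arguments.
Unset Strict Implicit.
Unset Printing Implicit Defensive.

Import Order.TTheory GRing.Theory Num.Theory.

Local Open Scope classical_set_scope.
Local Open Scope ring_scope.

Section Polytopes.
Variables (R : realType) (n : nat).
Implicit Types (A B C P S : set 'rV[R]_n).

Definition conv_hull S : set 'rV[R]_n :=
  smallest (@convex_set R 'rV[R]_n) S.

Definition polytope P := exists2 S, finite_set S & P = conv_hull S.

(* A vertex is a point that is not interior to any segment of P. *)
Definition vertex P (v : 'rV[R]_n) :=
  P v /\ forall (x y : 'rV[R]_n) (t : R), P x -> P y -> 0 < t < 1 ->
    v = t *: x + (1 - t) *: y -> x = v /\ y = v.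

Definition integral_point (v : 'rV[R]_n) :=
  forall i : 'I_n, exists z : int, v ord0 i = z%:~R.

Definition integral_polytope P :=
  polytope P /\ forall v, vertex P v -> integral_point v.

Definition minkowski_sum A B : set 'rV[R]_n :=
  [set a + b | a in A & b in B].

Definition has_two_points A := exists a b, [/\ A a, A b & a != b].

Definition integrally_decomposable C :=
  exists A B, [/\ integral_polytope A, integral_polytope B,
    has_two_points A, has_two_points B & C = minkowski_sum A B].

Definition integrally_indecomposable C :=
  integral_polytope C /\ ~ integrally_decomposable C.

Definition collinear (a b c : 'rV[R]_n) :=
  exists u v : 'rV[R]_n, v != 0 /\
    [set a; b; c] `<=` [set u + t *: v | t in [set: R]].

Definition triangle P :=
  exists a b c : 'rV[R]_n,
    [/\ [/\ a != b, a != c & b != c], ~ collinear a b c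
      & P = conv_hull [set a; b; c]].

End Polytopes.

Definition point2 (R : realType) (x y : R) : 'rV[R]_2 :=
  \row_(j < 2) (if j == ord0 then x else y).

Definition has_characteristic (k : fieldType) (p : nat) : Prop :=
  if p == 0%N then [pchar k] =i pred0 else p \in [pchar k].

Definition mpoly_irreducible (k : fieldType) (n : nat) (f : {mpoly k[n]}) :=
  [/\ f != 0, f \isn't a GRing.unit &
    forall g h : {mpoly k[n]}, f = g * h ->
      (exists2 c : k, c != 0 & g = c%:MP) \/
      (exists2 c : k, c != 0 & h = c%:MP)].

Definition absolutely_irreducible (k : fieldType) (n : nat)
    (f : {mpoly k[n]}) :=
  forall (K : fieldType) (iota : {rmorphism k -> K}),
    (forall z : K, algebraicOver iota z) ->
    mpoly_irreducible (map_mpoly iota f).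

Definition poly_at_var (k : fieldType) (n : nat) (i : 'I_n) (f : {poly k}) :
    {mpoly k[n]} :=
  (map_poly (@mpolyC n k) f).['X_i].

(* Main.v *)
From HB Require Import structures.
Require Import Defs.
From mathcomp Require Import all_boot all_order all_algebra.
From mathcomp Require Import boolp classical_sets cardinality reals convex.
From mathcomp.multinomials Require Import mpoly.
From mathcomp Require Import interval_inference zify ring lra.

(** The triangle. The hull of the three corners is cut out by the half-planes
    [0 <= y], [y <= (d-1) x] and [x + y <= d], which hold at every point
    [(i1, i2)] of the statement; so adding those points does not enlarge it
    ([conv_hull_corners]).
    Suppose the triangle is [A + B]. Each corner is a vertex of the triangle,
    hence splits as a sum of a vertex of [A] and a vertex of [B], which are
    integral. A linear form that is minimal along an edge of the triangle is
    minimal on [A] at the [A]-parts of both ends of that edge, so [A] is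
    enclosed by three lines parallel to the edges, through its three marked
    points ([triangle_summand]). Along the primitive edge from [(0,0)] to
    [(1,d-1)] the [x]-coordinate grows by 1, and this growth is shared between
    [A] and [B] in nonnegative integer parts: one of them gets 0, and a
    triangle with an edge of length 0 is a point.

    The polynomial. Put [y = x + t]. The triangle is the Newton polygon of
    [f(x) - f(x + t) + a] in the exponents of [t] and [x], and the shape that
    makes it indecomposable gives a direct proof of irreducibility over any
    field [K] in which [d] and [a] are nonzero. In [K[t][x]] the coefficients
    of [f(x) - f(x + t)] are given by Taylor's formula: the leading one is
    [-d f_d t] (plus [a] when [d = 1]), of degree 1 in [t]
    ([size_lead_coef_sheared]), and all of them vanish at [t = 0]
    ([sheared_difference0]). If the polynomial is [g h], one factor, say [g],
    has a leading coefficient free of [t], so [g(x,0)] has the same [x]-degree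
    as [g]; but [g(x,0) h(x,0) = a], so that degree is 0 and [g] is a constant
    ([factorization_const]). The substitution is injective, which brings the
    conclusion back to [K[x,y]]. *)

Import Order.TTheory GRing.Theory Num.Theory.

Local Open Scope classical_set_scope.
Local Open Scope ring_scope.

(** * Convex hulls, vertices and Minkowski sums *)

Section ConvexHulls.
Context {R : realType} {n : nat}.
Implicit Types (A B C S : set 'rV[R]_n) (x y v : 'rV[R]_n) (t : R).

Lemma convex_segment A x y t : @convex_set R 'rV[R]_n A ->
  A x -> A y -> 0 <= t <= 1 -> A (t *: x + (1 - t) *: y).
Proof.
move=> cA Ax Ay /andP[t0 t1].
by have := cA x y (Itv01 t0 t1); rewrite !inE; apply.
Qed.

Lemma convex_setP A : @convex_set R 'rV[R]_n A <->
  forall x y t, A x -> A y -> 0 < t < 1 -> A (t *: x + (1 - t) *: y).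
Proof.
split=> [cA x y t Ax Ay /andP[t0 t1]|cA].
  by apply: convex_segment => //; rewrite !ltW.
apply/convex_setW => x y /set_mem Ax /set_mem Ay k k0 k1.
by apply/mem_set/cA => //; rewrite k0.
Qed.

Lemma convex_comb3 A x y z (p q r : R) : @convex_set R 'rV[R]_n A ->
  A x -> A y -> A z -> 0 <= p -> 0 <= q -> 0 <= r -> p + q + r = 1 ->
  A (p *: x + q *: y + r *: z).
Proof.
move=> cA Ax Ay Az p0 q0 r0 pqr1; have [p1|p1] := eqVneq p 1.
  have -> : q = 0 by lra.
  have -> : r = 0 by lra.
  by rewrite p1 scale1r !scale0r !addr0.
have p_gt0 : 0 < 1 - p by rewrite subr_gt0 lt_neqAle p1; lra.
have qP : 0 <= q / (1 - p) <= 1.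
  by rewrite divr_ge0 ?(ltW p_gt0)//= ler_pdivrMr//; lra.
suff -> : p *: x + q *: y + r *: z =
    p *: x + (1 - p) *: (q / (1 - p) *: y + (1 - q / (1 - p)) *: z).
  apply: convex_segment => //; first exact: convex_segment.
  by apply/andP; split; lra.
rewrite -addrA; congr (_ + _); rewrite scalerDr !scalerA.
have -> : r = 1 - p - q by lra.
by congr (_ *: _ + _ *: _); field; rewrite gt_eqF.
Qed.

Lemma conv_hull_convex S : @convex_set R 'rV[R]_n (conv_hull S).
Proof.
apply/convex_setP => x y t Sx Sy t01 A [cA SA].
by move/convex_setP: (cA); apply=> //; [apply: Sx|apply: Sy].
Qed.

Lemma sub_conv_hull S : S `<=` conv_hull S.
Proof. exact: sub_gen_smallest. Qed.

Lemma conv_hull_min S A : @convex_set R 'rV[R]_n A -> S `<=` A ->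
  conv_hull S `<=` A.
Proof. exact: smallest_sub. Qed.

(** Removing an extreme point from a convex set leaves a convex set; if the
    point were outside [S], what is left would be a smaller convex set
    containing [S]. *)
Lemma vertex_conv_hull S v : vertex (conv_hull S) v -> S v.
Proof.
move=> [Sv ext_v]; apply: contrapT => nSv.
have : (conv_hull S `\ v) v.
  apply: (@conv_hull_min S) Sv; last first.
    move=> x Sx; split; first exact: sub_conv_hull.
    by move=> /= xv; rewrite -xv in nSv.
  apply/convex_setP => x y t [Sx xv] [Sy _] t01; split.
    by have /convex_setP := conv_hull_convex S; apply.
  by move=> /= /esym vE; have [] := ext_v x y t Sx Sy t01 vE.
by case=> _ /(_ erefl).
Qed.

Lemma minkowski_sumC A B : minkowski_sum A B = minkowski_sum B A.
Proof.
apply/seteqP; split=> _ [a Aa [b Bb <-]]; exists b => //; exists a => //;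
exact: addrC.
Qed.

(** A segment of [A] around [a], translated by [b], is a segment of the sum
    around [a + b]. *)
Lemma vertex_minkowski_suml A B a b : A a -> B b ->
  vertex (minkowski_sum A B) (a + b) -> vertex A a.
Proof.
move=> Aa Bb [_ ext]; split=> // x y t Ax Ay t01 aE.
have [| | |xb yb] := ext (x + b) (y + b) t _ _ t01.
- by exists x => //; exists b.
- by exists y => //; exists b.
- by rewrite !scalerDr addrACA -aE -scalerDl [t + _]addrC subrK scale1r.
by split; [exact: addIr xb|exact: addIr yb].
Qed.

(** Faces of a sum are sums of faces: keep [b] fixed and move [a] inside [A]. *)
Lemma support_minkowski_suml A B (f : 'rV[R]_n -> R) m a b :
  {morph f : x y / x + y} -> (forall c, minkowski_sum A B c -> m <= f c) ->
  B b -> f (a + b) = m -> forall u, A u -> f a <= f u.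
Proof.
move=> fD fge Bb fab u Au.
have : m <= f (u + b) by apply: fge; exists u => //; exists b.
by rewrite -fab !fD lerD2r.
Qed.

End ConvexHulls.

Lemma conv_face {R : realFieldType} (m u w t : R) : 0 < t < 1 ->
  m <= u -> m <= w -> t * u + (1 - t) * w = m -> u = m /\ w = m.
Proof.
move=> /andP[t0 t1] mu mw E.
by split; apply/eqP; rewrite eq_le ?mu ?mw andbT; nra.
Qed.

(** * The triangle with corners (0,0), (1,d-1), (d,0) *)

Section Triangle.
Context {R : realType}.
Implicit Types (u v : 'rV[R]_2) (D : R).

Definition xcoord v : R := v ord0 ord0.
Definition ycoord v : R := v ord0 ord_max.

Lemma coord2_eq u v : xcoord u = xcoord v -> ycoord u = ycoord v -> u = v.
Proof.
move=> ux uy; apply/rowP => -[[|[|//]] i].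
  by rewrite (_ : Ordinal i = ord0) //; apply/val_inj.
by rewrite (_ : Ordinal i = ord_max) //; apply/val_inj.
Qed.

Lemma xcoordD u v : xcoord (u + v) = xcoord u + xcoord v.
Proof. by rewrite /xcoord mxE. Qed.
Lemma ycoordD u v : ycoord (u + v) = ycoord u + ycoord v.
Proof. by rewrite /ycoord mxE. Qed.
Lemma xcoordZ (t : R) v : xcoord (t *: v) = t * xcoord v.
Proof. by rewrite /xcoord mxE. Qed.
Lemma ycoordZ (t : R) v : ycoord (t *: v) = t * ycoord v.
Proof. by rewrite /ycoord mxE. Qed.
Lemma xcoord_point2 (x y : R) : xcoord (point2 x y) = x.
Proof. by rewrite /xcoord mxE. Qed.
Lemma ycoord_point2 (x y : R) : ycoord (point2 x y) = y.
Proof. by rewrite /ycoord mxE. Qed.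

Definition coord2E := (xcoordD, ycoordD, xcoordZ, ycoordZ, xcoord_point2,
  ycoord_point2).

Definition corners D := [set point2 0 0; point2 1 (D - 1); point2 D 0].

(** The last inequality is [x + y <= D], turned into a lower bound so that the
    three sides are treated alike as minima of linear forms. *)
Definition triangle_region D := [set v | [/\ 0 <= ycoord v,
  0 <= (D - 1) * xcoord v - ycoord v & - D <= - (xcoord v + ycoord v)]].

Lemma triangle_region_convex D : @convex_set R 'rV[R]_2 (triangle_region D).
Proof.
apply/convex_setP => u v t [u1 u2 u3] [v1 v2 v3] /andP[t0 t1].
by split; rewrite !coord2E; nra.
Qed.

Lemma conv_hull_corners D : 2 <= D -> conv_hull (corners D) = triangle_region D.
Proof.
move=> D2; apply/seteqP; split.
  apply: conv_hull_min (triangle_region_convex D) _ => _ [[->|->]|->];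
    by split; rewrite !coord2E; nra.
move=> v [v1 v2 v3] A [/convex_setP cA cornA].
have AO : A (point2 0 0) by apply: cornA; left; left.
have AV : A (point2 1 (D - 1)) by apply: cornA; left; right.
have AW : A (point2 D 0) by apply: cornA; right.
have D1 : 0 < D - 1 by lra.
have D0 : 0 < D by lra.
set x := xcoord v in v2 v3; set y := ycoord v in v1 v2 v3.
(* barycentric coordinates of [v] with respect to the corners *)
suff -> : v = (y / (D - 1)) *: point2 1 (D - 1) +
    ((x - y / (D - 1)) / D) *: point2 D 0 +
    ((D - x - y) / D) *: point2 0 0.
  apply: convex_comb3 => //; first exact/convex_setP.
  - by rewrite divr_ge0 // ltW.
  - by rewrite divr_ge0 ?(ltW D0)// subr_ge0 ler_pdivrMr//; lra.
  - by rewrite divr_ge0 ?(ltW D0)//; lra.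
  - by field; rewrite !gt_eqF.
by apply: coord2_eq; rewrite !coord2E -?/x -?/y; field; rewrite !gt_eqF.
Qed.

Lemma triangle_corners D : 2 <= D -> triangle (conv_hull (corners D)).
Proof.
move=> D2; exists (point2 0 0), (point2 1 (D - 1)), (point2 D 0); split=> //.
  split; apply/eqP => /(congr1 xcoord); rewrite !coord2E; lra.
move=> [u [w [_ col]]].
have [] := col (point2 0 0); first by left; left.
move=> t0 _ E0.
have [] := col (point2 1 (D - 1)); first by left; right.
move=> t1 _ E1.
have [] := col (point2 D 0); first by right.
move=> t2 _ E2.
have := congr1 xcoord E0; have := congr1 ycoord E0.
have := congr1 xcoord E1; have := congr1 ycoord E1.
have := congr1 xcoord E2; have := congr1 ycoord E2.
rewrite !coord2E.
move: (xcoord u) (ycoord u) (xcoord w) (ycoord w) => ux uy wx wy *.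
(* the determinant of the two edge vectors at the origin *)
have : (t1 - t0) * wx * ((t2 - t0) * wy) = (t1 - t0) * wy * ((t2 - t0) * wx).
  by ring.
have -> : (t1 - t0) * wx = 1 by lra.
have -> : (t2 - t0) * wy = 0 by lra.
have -> : (t1 - t0) * wy = D - 1 by lra.
have -> : (t2 - t0) * wx = D by lra.
nra.
Qed.

(** Each corner lies on two of the three bounding lines, and a segment of the
    triangle through it stays on both of them. *)
Lemma vertex_corners D v : 2 <= D -> corners D v ->
  vertex (triangle_region D) v.
Proof.
move=> D2 cv; split.
  by rewrite -conv_hull_corners //; apply: sub_conv_hull.
move=> x y t [x1 x2 x3] [y1 y2 y3] t01 /esym E.
have E1 : t * ycoord x + (1 - t) * ycoord y = ycoord v.
  by rewrite -E !coord2E.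
have E2 : t * ((D - 1) * xcoord x - ycoord x) +
    (1 - t) * ((D - 1) * xcoord y - ycoord y) = (D - 1) * xcoord v - ycoord v.
  by rewrite -E !coord2E; ring.
have E3 : t * - (xcoord x + ycoord x) + (1 - t) * - (xcoord y + ycoord y) =
    - (xcoord v + ycoord v).
  by rewrite -E !coord2E; ring.
case: cv E1 E2 E3 => [[->|->]|->]; rewrite !coord2E => E1 E2 E3.
- have [x1E y1E] := conv_face _ _ _ _ t01 x1 y1 E1.
  have [|x2E y2E] := conv_face 0 _ _ _ t01 x2 y2; first by rewrite E2; ring.
  by split; apply: coord2_eq; rewrite !coord2E; nra.
- have [|x2E y2E] := conv_face 0 _ _ _ t01 x2 y2; first by rewrite E2; ring.
  have [|x3E y3E] := conv_face (- D) _ _ _ t01 x3 y3; first by rewrite E3; ring.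
  by split; apply: coord2_eq; rewrite !coord2E; nra.
- have [x1E y1E] := conv_face _ _ _ _ t01 x1 y1 E1.
  have [|x3E y3E] := conv_face (- D) _ _ _ t01 x3 y3; first by rewrite E3; ring.
  by split; apply: coord2_eq; rewrite !coord2E; nra.
Qed.

Lemma integral_corners (d : nat) : (2 <= d)%N ->
  integral_polytope (conv_hull (corners (d%:R : R))).
Proof.
move=> d2; split.
  exists (corners d%:R) => //; rewrite /corners !finite_setU.
  by split; [split|]; exact: finite_set1.
move=> v /vertex_conv_hull cv i.
case: cv => [[->|->]|->]; rewrite mxE; case: ifP => _.
- by exists 0.
- by exists 0.
- by exists 1.
- by exists (d%:Z - 1); rewrite rmorphB.
- by exists d%:Z.
- by exists 0.
Qed.

(** Each corner of the triangle lies on two sides, so each of the three linear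
    forms is minimal on [A] at two of the points [ao], [av], [aw]. The height
    of [av] above [ao] is then [D - 1] times its horizontal displacement, which
    is therefore nonnegative; if it is zero, the three bounding lines of [A]
    pass through the common point [ao]. *)
Lemma triangle_summand D (A B : set 'rV[R]_2) ao av aw bo bv bw :
  2 <= D -> triangle_region D = minkowski_sum A B ->
  A ao -> A av -> A aw -> B bo -> B bv -> B bw ->
  ao + bo = point2 0 0 -> av + bv = point2 1 (D - 1) -> aw + bw = point2 D 0 ->
  xcoord ao <= xcoord av /\
  (xcoord av = xcoord ao -> ~ has_two_points A).
Proof.
move=> D2 triE Aao Aav Aaw Bbo Bbv Bbw oE vE wE.
have ge1 c : minkowski_sum A B c -> 0 <= ycoord c by rewrite -triE => -[].
have ge2 c : minkowski_sum A B c -> 0 <= (D - 1) * xcoord c - ycoord c.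
  by rewrite -triE => -[].
have ge3 c : minkowski_sum A B c -> - D <= - (xcoord c + ycoord c).
  by rewrite -triE => -[].
have add2 : {morph (fun c => (D - 1) * xcoord c - ycoord c) : x y / x + y}.
  by move=> x y /=; rewrite !coord2E; ring.
have add3 : {morph (fun c => - (xcoord c + ycoord c)) : x y / x + y}.
  by move=> x y /=; rewrite !coord2E; ring.
(* The letter names the corner and the digit the linear form: [y], then
   [(D-1) x - y], then [-(x+y)]. *)
have o1 := support_minkowski_suml A B ycoord 0 ao bo ycoordD ge1 Bbo
  ltac:(by rewrite oE !coord2E).
have w1 := support_minkowski_suml A B ycoord 0 aw bw ycoordD ge1 Bbw
  ltac:(by rewrite wE !coord2E).
have o2 := support_minkowski_suml A B _ 0 ao bo add2 ge2 Bbo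
  ltac:(by rewrite /= oE !coord2E; ring).
have v2 := support_minkowski_suml A B _ 0 av bv add2 ge2 Bbv
  ltac:(by rewrite /= vE !coord2E; ring).
have v3 := support_minkowski_suml A B _ (- D) av bv add3 ge3 Bbv
  ltac:(by rewrite /= vE !coord2E; ring).
have w3 := support_minkowski_suml A B _ (- D) aw bw add3 ge3 Bbw
  ltac:(by rewrite /= wE !coord2E; ring).
move: (o1 _ Aav) (o1 _ Aaw) (w1 _ Aao) (o2 _ Aav) (v2 _ Aao) (v3 _ Aaw)
  (w3 _ Aav) => /= o1v o1w w1o o2v v2o v3w w3v.
split=> [|vo [a [b [Aa Ab /eqP]]]]; first nra.
apply; suff Ao u : A u -> u = ao by rewrite (Ao a) // (Ao b).
move=> Au; move: (o1 u Au) (o2 u Au) (w3 u Au) => /= *.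
by apply: coord2_eq; nra.
Qed.

Lemma indecomposable_corners (d : nat) : (2 <= d)%N ->
  integrally_indecomposable (conv_hull (corners (d%:R : R))).
Proof.
move=> d2; split; first exact: integral_corners.
have D2 : (2 : R) <= d%:R by rewrite ler_nat.
set D : R := d%:R in D2 *.
rewrite (conv_hull_corners _ D2) => -[A [B [[_ intA] [_ intB] A2 B2 triE]]].
have triE' : triangle_region D = minkowski_sum B A by rewrite minkowski_sumC.
have split_corner v : corners D v -> exists a b,
    [/\ A a, B b, a + b = v, integral_point a & integral_point b].
  move=> /(vertex_corners _ _ D2); rewrite triE => vv.
  have [[a Aa [b Bb ab]] _] := vv; exists a, b; rewrite -ab in vv.
  split=> //; first exact/intA/(vertex_minkowski_suml A B a b).
  apply/intB/(vertex_minkowski_suml B A b a) => //.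
  by rewrite minkowski_sumC addrC.
have [ao [bo [Aao Bbo oE iao ibo]]] := split_corner (point2 0 0)
  (or_introl (or_introl erefl)).
have [av [bv [Aav Bbv vE iav ibv]]] := split_corner (point2 1 (D - 1))
  (or_introl (or_intror erefl)).
have [aw [bw [Aaw Bbw wE _ _]]] := split_corner (point2 D 0) (or_intror erefl).
have [Ale Atriv] := triangle_summand D A B ao av aw bo bv bw D2 triE
  Aao Aav Aaw Bbo Bbv Bbw oE vE wE.
have [Ble Btriv] := triangle_summand D B A bo bv bw ao av aw D2 triE'
  Bbo Bbv Bbw Aao Aav Aaw
  ltac:(by rewrite addrC) ltac:(by rewrite addrC) ltac:(by rewrite addrC).
have := congr1 xcoord oE; have := congr1 xcoord vE; rewrite !coord2E => xv xo.
have [[zo zoE] [zv zvE]] := (iao ord0, iav ord0).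
rewrite -/(xcoord _) in zoE; rewrite -/(xcoord _) in zvE.
have le0 : zo <= zv by rewrite -(ler_int R) -zoE -zvE.
have le1 : zv <= zo + 1.
  by rewrite -(ler_int R) rmorphD /= -zoE -zvE; lra.
(* the unit horizontal length of the edge cannot be shared by both summands *)
have [zvo|zvo] : zv = zo \/ zv = zo + 1 by lia.
  by apply: Atriv => //; rewrite zvE zoE zvo.
apply: Btriv => //.
have : xcoord av = xcoord ao + 1 by rewrite zvE zoE zvo rmorphD.
lra.
Qed.

End Triangle.

(** * Factoring f(x) - f(y) + a *)

(** Taylor's formula, read with the increment as the variable and the
    translation [c] as the base point. *)
Lemma coef_comp_polyXaddC (A : comNzRingType) (q : {poly A}) (c : A) (j : nat) :
  (q \Po ('X + c%:P))`_j = q^`N(j).[c].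
Proof.
rewrite /comp_poly addrC nderiv_taylor; last exact: mulrC.
rewrite size_map_polyC.
under eq_bigr => i _ do rewrite nderivn_map horner_map.
rewrite coef_sum.
under eq_bigr => i _ do rewrite coefCM coefXn.
have [ltj|lej] := ltnP j (size q).
  rewrite (bigD1 (Ordinal ltj)) //= eqxx mulr1 big1 ?addr0 // => i /eqP ij.
  by case: eqP => [ji|_]; [case: ij; apply/val_inj|rewrite mulr0].
rewrite big1 => [|i _]; last by rewrite gtn_eqF ?mulr0 // (leq_trans _ lej).
by rewrite nderivn_poly0 // horner0.
Qed.

Section Shear.
Context {K : fieldType}.
Implicit Types (f : {poly K}) (F g h : {poly {poly K}}).

(** This is [f(x) - f(x + t)] in [K[t][x]]: the outer variable is [x], and the
    inner one, embedded by [%:P], is [t]. *)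
Definition sheared_difference f : {poly {poly K}} :=
  f^:P - (f^:P \Po ('X + 'X%:P)).

(** The divided derivatives on the right are polynomials in [t]: evaluating the
    lift of [f^`N(j)] at [t] gives it back. *)
Lemma coef_sheared_difference f j :
  (sheared_difference f)`_j = (f`_j)%:P - f^`N(j).
Proof.
rewrite coefB coef_comp_polyXaddC coef_map nderivn_map.
by rewrite -[X in _ - X]/(f^`N(j) \Po 'X) comp_polyXr.
Qed.

(** At [t = 0] the two terms of the difference coincide. *)
Lemma sheared_difference0 f :
  map_poly (horner_eval 0) (sheared_difference f) = 0.
Proof.
apply/polyP => j; rewrite coef_map coef_sheared_difference coef0 /=.
by rewrite rmorphB /= /horner_eval hornerC horner_coef0 coef_nderivn addn0 binn
  mulr1n subrr.
Qed.

(** The terms of [x]-degree [d] cancel, and the coefficient of [x^(d-1)] is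
    [- d f_d t] up to a term that is nonzero only if [d = 1] (namely [a]). *)
Lemma size_lead_coef_sheared f (a : K) :
  (0 < (size f).-1)%N -> (size f).-1%:R != 0 :> K ->
  size (lead_coef (sheared_difference f + a%:P%:P)) = 2.
Proof.
set d := (size f).-1 => d_gt0 d_neq0.
have szf : size f = d.+1 by rewrite prednK // (leq_trans d_gt0) ?leq_pred.
have fd0 : f`_d != 0 by rewrite -lead_coefE lead_coef_eq0 -size_poly_gt0 szf.
set F := _ + _.
have FE j : F`_j = (f`_j + (if j == 0 then a else 0))%:P - f^`N(j).
  rewrite coefD coef_sheared_difference coefC polyCD [RHS]addrAC.
  by case: eqP.
have Fd1 : size F`_d.-1 = 2%N.
  apply/anti_leq/andP; split.
    apply/leq_sizeP => i i2; rewrite FE coefB coefC coef_nderivn.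
    rewrite gtn_eqF ?(leq_trans _ i2) // sub0r.
    by rewrite [f`__]nth_default ?mul0rn ?oppr0 // szf; lia.
  rewrite ltnNge; apply/negP => /leq_sizeP/(_ 1 isT).
  have binE : 'C(d, d.-1) = d by case: (d) d_gt0 => // e _; rewrite binSn.
  rewrite FE coefB coefC coef_nderivn /= sub0r addn1 prednK // binE => /eqP.
  by rewrite oppr_eq0 -mulr_natr mulf_eq0 (negPf fd0) (negPf d_neq0).
have szF : size F = d.
  apply/anti_leq/andP; split.
    apply/leq_sizeP => j dj; rewrite FE gtn_eqF ?(leq_trans d_gt0)//.
    apply/polyP => i; rewrite addr0 coefB coefC coef_nderivn coef0.
    case: eqP => [->|i0]; first by rewrite addn0 binn subrr.
    by rewrite [f`__]nth_default ?mul0rn ?subr0 // szf; lia.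
  rewrite leqNgt; apply/negP => szF; move: Fd1.
  by rewrite nth_default ?size_poly0 // -ltnS prednK.
by rewrite lead_coefE szF.
Qed.

(** Evaluation at [t = 0] preserves the [x]-degree of [g], as its leading
    coefficient is a constant; but it makes [g] divide a nonzero constant. *)
Lemma factor_const g h (a : K) : a != 0 ->
  map_poly (horner_eval 0) (g * h) = a%:P -> size (lead_coef g) = 1 ->
  exists2 c : K, c != 0 & g = c%:P%:P.
Proof.
rewrite rmorphM /= => a0 ghE /eqP/size_poly1P [c c0 lg].
have : size (map_poly (horner_eval 0) g * map_poly (horner_eval 0) h) = 1.
  by rewrite ghE size_polyC a0.
have szg : size (map_poly (horner_eval (0 : K)) g) = size g.
  by rewrite size_map_poly_id0 // lg /horner_eval hornerC.
move/eqP; rewrite size_mul_eq1 szg => /andP[/size_poly1P [q q0 gE] _].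
by exists c => //; rewrite -lg gE lead_coefC.
Qed.

(** A leading coefficient of degree 1 in [t] is a product of two factors, one of
    which is a constant. *)
Lemma factorization_const g h (a : K) : a != 0 ->
  map_poly (horner_eval 0) (g * h) = a%:P -> size (lead_coef (g * h)) = 2 ->
  (exists2 c : K, c != 0 & g = c%:P%:P) \/
  (exists2 c : K, c != 0 & h = c%:P%:P).
Proof.
move=> a0 ghE; rewrite lead_coefM => lc2.
have [g0 h0] : lead_coef g != 0 /\ lead_coef h != 0.
  by apply/andP; rewrite -negb_or -mulf_eq0 -size_poly_gt0 lc2.
move: lc2; rewrite size_mul // => lc2.
have [lg|lh] : size (lead_coef g) = 1 \/ size (lead_coef h) = 1.
- by move: g0 h0; rewrite -!size_poly_gt0; move: lc2;
    do 2 case: (size _) => [|?] //; lia.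
- by left; apply: factor_const a0 ghE lg.
- by right; apply: factor_const a0 _ lh; rewrite mulrC; exact: ghE.
Qed.

(** The change of variables [x := x], [y := x + t]. *)
Definition shear : {mpoly K[2]} -> {poly {poly K}} :=
  mmap (polyC \o polyC)
    (fun i : 'I_2 => if i == ord0 then 'X else 'X + 'X%:P).

HB.instance Definition _ := GRing.RMorphism.on shear.

(** The inverse change of variables, with [t := y - x] on the coefficients. *)
Definition unshear_coef : {poly K} -> {mpoly K[2]} :=
  horner_eval ('X_ord_max - 'X_ord0) \o map_poly (@mpolyC 2 K).

HB.instance Definition _ := GRing.RMorphism.on unshear_coef.

Definition unshear : {poly {poly K}} -> {mpoly K[2]} :=
  horner_eval 'X_ord0 \o map_poly unshear_coef.

HB.instance Definition _ := GRing.RMorphism.on unshear.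

Lemma unshearC (c : K) : unshear c%:P%:P = c%:MP.
Proof.
by rewrite /unshear /= map_polyC /horner_eval hornerC /= /unshear_coef /=
  map_polyC /horner_eval hornerC.
Qed.

Lemma shearK : cancel shear unshear.
Proof.
move=> p; rewrite {2}[p]mpolyE /shear /mmap rmorph_sum; apply: eq_bigr => m _.
rewrite rmorphM /= unshearC mul_mpolyC; congr (_ *: _).
rewrite [RHS]mpolyXE_id /mmap1 rmorph_prod; apply: eq_bigr => i _.
rewrite rmorphXn; congr (_ ^+ _).
have unX : unshear 'X = 'X_ord0.
  by rewrite /unshear /= map_polyX /horner_eval hornerX.
case: eqP => [->//|/eqP i0]; rewrite rmorphD /= unX.
have -> : unshear 'X%:P = 'X_ord_max - 'X_ord0.
  rewrite /unshear /= map_polyC /horner_eval hornerC /= /unshear_coef /=.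
  by rewrite map_polyX /horner_eval hornerX.
rewrite addrC subrK; congr 'X_ _; apply/val_inj.
by case: i i0 => -[|[|]].
Qed.

Lemma shear_poly_at_var (i : 'I_2) f :
  shear (poly_at_var i f) = f^:P \Po shear 'X_i.
Proof.
rewrite /poly_at_var -horner_map -map_poly_comp /comp_poly -map_poly_comp.
congr (_.[_]); apply: eq_map_poly => c /=.
by rewrite /shear mmapC.
Qed.

Lemma shear_difference f (a : K) :
  shear (poly_at_var ord0 f - poly_at_var ord_max f + a%:MP) =
  sheared_difference f + a%:P%:P.
Proof.
rewrite rmorphD rmorphB /= !shear_poly_at_var /shear mmapC !mmapX !mmap1U /=.
by rewrite comp_polyXr.
Qed.

Lemma irreducible_difference f (a : K) : (0 < (size f).-1)%N ->
  (size f).-1%:R != 0 :> K -> a != 0 ->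
  mpoly_irreducible
    (poly_at_var (ord0 : 'I_2) f - poly_at_var ord_max f + a%:MP).
Proof.
move=> d_gt0 d_neq0 a0; set F := _ + _.
have lcF : size (lead_coef (shear F)) = 2.
  by rewrite shear_difference size_lead_coef_sheared.
have F0 : map_poly (horner_eval 0) (shear F) = a%:P.
  rewrite shear_difference rmorphD /= sheared_difference0 add0r map_polyC /=.
  by rewrite /horner_eval hornerC.
split.
- apply/eqP => FE; move: lcF; rewrite FE rmorph0 lead_coef0 size_poly0 //.
  (* the leading coefficient of a unit of [K[t][x]] is its constant term and is
     a unit of [K[t]], so of [t]-degree 0 *)
- apply/negP => /(rmorph_unit shear); rewrite poly_unitE.
  move=> /andP[/eqP sz1]; rewrite poly_unitE => /andP[/eqP + _].
  by move: lcF; rewrite lead_coefE sz1 => ->.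
- move=> g h FE; move: lcF F0; rewrite FE rmorphM => lcF F0.
  have [[c c0 gE]|[c c0 hE]] := factorization_const _ _ _ a0 F0 lcF.
    by left; exists c => //; rewrite -[g]shearK gE unshearC.
  by right; exists c => //; rewrite -[h]shearK hE unshearC.
Qed.

End Shear.

Lemma map_mpoly_poly_at_var (k K : fieldType) (iota : {rmorphism k -> K}) n
    (i : 'I_n) (f : {poly k}) :
  map_mpoly iota (poly_at_var i f) = poly_at_var i (map_poly iota f).
Proof.
rewrite /poly_at_var -horner_map /= map_mpolyX -!map_poly_comp.
by congr (_.[_]); apply: eq_map_poly => c /=; rewrite map_mpolyC.
Qed.

Lemma natr_neq0_of_coprime (k : fieldType) (p d : nat) :
  has_characteristic k p -> (0 < d)%N -> ((0 < p)%N -> gcdn d p = 1%N) ->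
  d%:R != 0 :> k.
Proof.
rewrite /has_characteristic; have [->|p0] := eqVneq p 0%N.
  by move=> /pcharf0P -> ; rewrite -lt0n.
rewrite -lt0n in p0 => pk d_gt0 /(_ p0) dp.
rewrite -(dvdn_pcharf pk) -prime_coprime ?(pcharf_prime pk) //.
by rewrite coprime_sym /coprime dp.
Qed.

Theorem proposition11 (R : realType) (k : fieldType) (p : nat)
    (char_k : has_characteristic k p) :
  (forall d : nat, (2 <= d)%N ->
    let vertices := [set point2 (0 : R) 0; point2 1 (d%:R - 1);
                         point2 d%:R 0] in
    let points := [set z : 'rV[R]_2 | exists i1 i2 : nat,
      [/\ (1 <= i1)%N, (1 <= i2)%N, (2 <= i1 + i2 <= d)%N
        & z = point2 i1%:R i2%:R]] in
    [/\ conv_hull (vertices `|` points) = conv_hull vertices,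
        triangle (conv_hull vertices)
      & integrally_indecomposable (conv_hull vertices)])
  /\
  (forall (f : {poly k}) (d : nat) (a : k),
    d = (size f).-1 -> (0 < d)%N -> a != 0 ->
    ((0 < p)%N -> gcdn d p = 1%N) ->
    absolutely_irreducible
      (poly_at_var (ord0 : 'I_2) f - poly_at_var (ord_max : 'I_2) f + a%:MP)).
Proof.
split=> [d d2 vertices points|f d a dE d_gt0 a0 dp K iota _].
  have D2 : (2 : R) <= d%:R by rewrite ler_nat.
  have hullE := conv_hull_corners d%:R D2.
  split; [|exact: triangle_corners|exact: indecomposable_corners].
  apply/seteqP; split.
    apply: conv_hull_min (conv_hull_convex _) _ => v [|].
      exact: sub_conv_hull.
    rewrite hullE => -[i1 [i2 [i1_gt0 i2_gt0 /andP[_ i12] ->]]].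
    have x1 : (1 : R) <= i1%:R by rewrite ler1n.
    have y1 : (1 : R) <= i2%:R by rewrite ler1n.
    have xy : (i1%:R + i2%:R : R) <= d%:R by rewrite -natrD ler_nat.
    by split; rewrite !coord2E; nra.
  apply: conv_hull_min (conv_hull_convex _) _ => v vv.
  by apply: sub_conv_hull; left.
rewrite rmorphD rmorphB /= !map_mpoly_poly_at_var map_mpolyC.
by apply: irreducible_difference; rewrite ?size_map_poly -?dE // ?fmorph_eq0 //
  -(rmorph_nat iota) fmorph_eq0 (natr_neq0_of_coprime _ _ _ char_k).
Qed.
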